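(* Let $P$ be a poset with least element $0$ and with $Z(P)^\times\neq\emptyset$, and suppose $P$ is a poset with ACC for annihilators. Then \[|\mathrm{Ann}(P)|=\omega(P).\] In particular, $|\mathrm{Ann}(P)|\geq 3$ if and only if $|V(\Gamma_E(P))|\geq 3$.
   Context: For a poset $P$ with least element $0$ and $x,y\in P$: $L(x,y)=\{z\in P\mid z\le x,\ z\le y\}$, $\mathrm{ann}(x)=\{y\in P\mid L(x,y)=\{0\}\}$, $P^\times=P\setminus\{0\}$. An element $x\in P$ is a zero-divisor if $L(x,y)=\{0\}$ for some $y\in P^\times$; $Z(P)$ is the set of zero-divisors and $Z(P)^\times=Z(P)\setminus\{0\}$. An ideal of $P$ is a non-empty down-closed subset $I\subseteq P$ (no directedness is required). A prime ideal is an ideal $\mathfrak p\neq P$ such that for all $x,y\in P$, $L(x,y)\subseteq\mathfrak p$ implies $x\in\mathfrak p$ or $y\in\mathfrak p$. An annihilator prime ideal is a prime ideal of the form $\mathrm{ann}(x)$ with $x\in P$; $\mathrm{Ann}(P)$ is the set of all annihilator prime ideals. $\Gamma(P)$ is the simple graph with vertex set $Z(P)^\times$ in which $x$ and $y$ are adjacent iff $L(x,y)=\{0\}$. A clique is a set of pairwise adjacent vertices, and $\omega(P)$ is the clique number of $\Gamma(P)$, i.e. the least upper bound of the sizes of all cliques of $\Gamma(P)$. Write $x\sim y$ if $\mathrm{ann}(x)=\mathrm{ann}(y)$, and $[x]$ for the class of $x$. $\Gamma_E(P)$ is the simple graph whose vertices are the classes $[x]$, $x\in Z(P)^\times$, with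 $[x]$ and $[y]$ adjacent iff $L(x,y)=\{0\}$ (this is well defined). $P$ is a poset with ACC for annihilators if there is no infinite strictly ascending chain, under inclusion, in the set $\{\mathrm{ann}(x)\mid x\in P^\times\}$. *)

(* Defs.v *)
From mathcomp Require Import all_boot all_order.
From mathcomp Require Import boolp classical_sets functions cardinality.

Set Implicit Arguments.
Unset Strict Implicit.
Unset Printing Implicit Defensive.

Import Order.TTheory.

Local Open Scope classical_set_scope.
Local Open Scope order_scope.
Local Open Scope card_scope.

Section Annihilators.
Context {d : Order.disp_t} {P : bPOrderType d}.
Implicit Types (x y z : P) (I : set P).

Definition lower_cone x y : set P := [set z | z <= x /\ z <= y].

Definition ann x : set P := [set y | lower_cone x y = [set \bot]].

Definition nonzero : set P := [set x | x <> \bot].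

Definition zero_divisors : set P :=
  [set x | exists2 y, nonzero y & lower_cone x y = [set \bot]].

Definition nonzero_zero_divisors : set P := zero_divisors `\ \bot.

Definition is_ideal I : Prop :=
  I !=set0 /\ forall x y, y <= x -> I x -> I y.

Definition is_prime_ideal I : Prop :=
  [/\ is_ideal I, I <> setT
    & forall x y, lower_cone x y `<=` I -> I x \/ I y].

Lemma lower_coneC x y : lower_cone x y = lower_cone y x.
Proof. by apply/seteqP; split=> z [zx zy]; split. Qed.

Lemma lower_cone_self x : lower_cone x x = [set \bot] -> x = \bot.
Proof.
move=> Lxx; suff : lower_cone x x x by rewrite Lxx.
by split.
Qed.

Definition ann_class x : set P := [set y | ann x = ann y].

End Annihilators.

Arguments nonzero {d} P.
Arguments zero_divisors {d} P.
Arguments nonzero_zero_divisors {d} P.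

Definition Ann {d : Order.disp_t} (P : bPOrderType d) : set (set P) :=
  [set p | is_prime_ideal p /\ exists x : P, p = ann x].

Arguments Ann {d} P.

Definition ACC_for_annihilators {d : Order.disp_t} (P : bPOrderType d) : Prop :=
  ~ exists f : nat -> set P,
      (forall n, [set ann x | x in nonzero P] (f n)) /\
      (forall n, f n `<` f n.+1).

(* A simple graph whose vertices form a subset of [V]; [adj] is only
   meaningful on [vertices]. *)
Record simple_graph (V : Type) := SimpleGraph {
  vertices : set V;
  adj : V -> V -> Prop;
  adj_sym : forall u v, vertices u -> vertices v -> adj u v -> adj v u;
  adj_irrefl : forall u, vertices u -> ~ adj u u
}.

Definition clique {V : Type} (G : simple_graph V) (C : set V) : Prop :=
  C `<=` vertices G /\ forall u v, C u -> C v -> u <> v -> adj G u v.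

(* Cardinals are represented by sets, compared with [#<=]: [A] has the
   cardinality of the clique number of [G] when it is a least upper bound,
   among all cardinals (finite or infinite), of the sizes of the cliques. *)
Definition card_eq_clique_number {U V : Type}
    (A : set U) (G : simple_graph V) : Prop :=
  (forall C, clique G C -> C #<= A) /\
  (forall (W : Type) (B : set W),
     (forall C, clique G C -> C #<= B) -> A #<= B).

Section ZeroDivisorGraphs.
Context {d : Order.disp_t} (P : bPOrderType d).

Lemma Gamma_sym (x y : P) :
  lower_cone x y = [set \bot] -> lower_cone y x = [set \bot].
Proof. by rewrite lower_coneC. Qed.

Lemma Gamma_irrefl (x : P) :
  nonzero_zero_divisors P x -> ~ lower_cone x x = [set \bot].
Proof. by move=> [_ x0] /lower_cone_self. Qed.

Definition Gamma : simple_graph P :=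
  {| vertices := nonzero_zero_divisors P;
     adj := fun x y => lower_cone x y = [set \bot];
     adj_sym := fun x y _ _ => @Gamma_sym x y;
     adj_irrefl := Gamma_irrefl |}.

Definition Gamma_E_vertices : set (set P) :=
  [set ann_class x | x in nonzero_zero_divisors P].

Definition Gamma_E_adj (X Y : set P) : Prop :=
  exists x y : P, [/\ nonzero_zero_divisors P x, nonzero_zero_divisors P y,
    X = ann_class x, Y = ann_class y & lower_cone x y = [set \bot]].

Lemma ann_class_inj (x y : P) : ann_class x = ann_class y -> ann x = ann y.
Proof.
move=> xy; suff : ann_class y x by move=> ->.
by rewrite -xy.
Qed.

Lemma Gamma_E_adj_class (x y : P) :
    nonzero_zero_divisors P x -> nonzero_zero_divisors P y ->
  Gamma_E_adj (ann_class x) (ann_class y) <-> lower_cone x y = [set \bot].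
Proof.
move=> Zx Zy; split; last by move=> Lxy; exists x, y.
move=> [x' [y' [_ _ /ann_class_inj xx' /ann_class_inj yy' Lxy']]].
have : ann x' y' by [].
rewrite -xx' /ann /= lower_coneC => Ly'x.
have : ann y' x by [].
by rewrite -yy' /ann /= lower_coneC.
Qed.

Lemma Gamma_E_sym (X Y : set P) : Gamma_E_adj X Y -> Gamma_E_adj Y X.
Proof.
by move=> [x [y [Zx Zy -> -> Lxy]]]; exists y, x; split=> //; exact: Gamma_sym.
Qed.

Lemma Gamma_E_irrefl (X : set P) : Gamma_E_vertices X -> ~ Gamma_E_adj X X.
Proof.
by move=> [x Zx <-] /(Gamma_E_adj_class Zx Zx); exact: Gamma_irrefl.
Qed.

Definition Gamma_E : simple_graph (set P) :=
  {| vertices := Gamma_E_vertices;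
     adj := Gamma_E_adj;
     adj_sym := fun X Y _ _ => @Gamma_E_sym X Y;
     adj_irrefl := Gamma_E_irrefl |}.

End ZeroDivisorGraphs.

Arguments Gamma {d} P.
Arguments Gamma_E {d} P.

(* Main.v *)
(* An annihilator that is maximal among the [ann u] with [u] nonzero below [c]
   is prime and misses [c]; the annihilator condition provides one for every
   nonzero [c].  Picking such a prime for each vertex of a clique is injective,
   since a prime missing [c] contains everything orthogonal to [c].  Conversely
   generators of distinct annihilator primes are orthogonal, so they form a
   clique.  Finally [ann z] is the intersection of the annihilator primes
   missing [z], and for a nonzero zero-divisor [z] those primes form a nonempty
   proper subfamily; two primes leave room for only two such subfamilies. *)
Require Import Defs.
From mathcomp Require Import all_boot all_order.
From mathcomp Require Import boolp classical_sets functions cardinality.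

Set Implicit Arguments.
Unset Strict Implicit.
Unset Printing Implicit Defensive.

Local Open Scope classical_set_scope.
Local Open Scope card_scope.

Lemma card_le_inj_in {T U : Type} (A : set T) (B : set U) (f : T -> U) :
  (forall x, A x -> B (f x)) ->
  (forall x y, A x -> A y -> f x = f y -> x = y) -> A #<= B.
Proof.
move=> fAB finj; have : f @` A #= A.
  by apply: inj_card_eq => x y /set_mem Ax /set_mem Ay; exact: finj.
rewrite card_eq_le => /andP[_ lefA].
apply: card_le_trans lefA _.
by apply: subset_card_le => _ [x Ax <-]; exact: fAB.
Qed.

Lemma card_le_I3P {T : Type} (A : set T) :
  `I_3 #<= A <->
  exists a b c, [/\ A a, A b & A c] /\ [/\ a <> b, a <> c & b <> c].
Proof.
split=> [/card_leP[f]|[a [b [c [[Aa Ab Ac] [ab ac bc]]]]]].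
  pose s i (i3 : (i < 3)%N) : `I_3 := exist _ i (mem_set (i3 : `I_3 i)).
  pose e i (i3 : (i < 3)%N) : T := val (f (s i i3)).
  have eA i (i3 : (i < 3)%N) : A (e i i3) by exact: set_mem (valP (f (s i i3))).
  have eI i j (i3 : (i < 3)%N) (j3 : (j < 3)%N) : e i i3 = e j j3 -> i = j.
    move=> /val_inj eij; suff [] : s i i3 = s j j3 by [].
    by apply: (@inj _ _ _ f) => //; exact: mem_set.
  exists (e 0 isT), (e 1 isT), (e 2 isT).
  by split; split; try exact: eA; move/eI.
(* The default [c] is the value at index 2. *)
apply: (@card_le_inj_in _ _ _ _ (fun i => nth c [:: a; b] i)).
  by case=> [|[|[|]]].
by move=> [|[|[|i]]] [|[|[|j]]] //= _ _ // /esym.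
Qed.

Section AnnihilatorPrimes.
Context {d : Order.disp_t} {P : bPOrderType d}.
Implicit Types (x y z u v : P) (p q : set P).

Import Order.TTheory.
Local Open Scope order_scope.

Lemma lower_cone_bot x y : lower_cone x y \bot.
Proof. by split; exact: le0x. Qed.

Lemma annP x y : ann x y <-> forall z, z <= x -> z <= y -> z = \bot.
Proof.
split=> [axy z zx zy|Lxy].
  by have : lower_cone x y z by []; rewrite axy.
apply/seteqP; split=> [z [zx zy]|_ ->]; [exact: Lxy|exact: lower_cone_bot].
Qed.

Lemma ann_sym x y : ann x y -> ann y x.
Proof. by rewrite /ann /= lower_coneC. Qed.

Lemma ann_bot x : ann x \bot.
Proof. by apply/annP => z _; rewrite lex0 => /eqP. Qed.

Lemma ann_down x y z : z <= y -> ann x y -> ann x z.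
Proof.
by move=> zy /annP axy; apply/annP => w wx wz; apply: axy => //; exact: le_trans zy.
Qed.

Lemma ann_anti x y : x <= y -> ann y `<=` ann x.
Proof. by move=> xy z /ann_sym yz; apply/ann_sym/(ann_down xy). Qed.

Lemma ann_self x : ann x x -> x = \bot.
Proof. exact: lower_cone_self. Qed.

Lemma not_annP x y : ~ ann x y -> exists z, [/\ z <= x, z <= y & nonzero P z].
Proof.
move=> naxy; apply: contrapT => nex; apply: naxy; apply/annP => z zx zy.
by apply: contrapT => z0; apply: nex; exists z.
Qed.

Lemma prime_down {p y z} : is_prime_ideal p -> z <= y -> p y -> p z.
Proof. by move=> [[_ down] _ _] zy; exact: down. Qed.

Lemma prime_ann p x y : is_prime_ideal p -> ann x y -> p x \/ p y.
Proof.
move=> [[[w pw] down] _ prime] axy; apply: prime; rewrite axy => _ ->.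
exact: down (le0x w) pw.
Qed.

Lemma Ann_generator_neq0 x : Ann P (ann x) -> nonzero P x.
Proof.
move=> [[_ axT _] _] x0; apply: axT.
by rewrite x0; apply/seteqP; split=> // y _; exact/ann_sym/ann_bot.
Qed.

(** Distinct annihilators fail one of the two inclusions. If some [t] orthogonal to [u] lies outside
    the prime [ann v], primality puts [u] in [ann v]. *)
Lemma Ann_orthogonal x y :
  Ann P (ann x) -> Ann P (ann y) -> ann x <> ann y -> ann x y.
Proof.
have half u v : is_prime_ideal (ann v) -> ~ ann u `<=` ann v -> ann u v.
  move=> pv; apply: contra_notP => nuv t ut.
  by case: (prime_ann pv ut) => // /ann_sym.
move=> [px _] [py _] xy.
have [sxy|] := pselect (ann x `<=` ann y); last exact: half.
apply/ann_sym/half => // syx; apply: xy; exact/seteqP.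
Qed.

Lemma maximal_ann_prime c x : nonzero P x -> x <= c ->
    (forall u, nonzero P u -> u <= c -> ~ ann x `<` ann u) ->
  is_prime_ideal (ann x).
Proof.
move=> x0 xc xmax; split.
- by split=> [|y z]; [exists \bot; exact: ann_bot|exact: ann_down].
- by move=> axT; apply: x0; apply: ann_self; rewrite axT.
move=> a b Lab; have [|/not_annP[u [ux ua u0]]] := pselect (ann x a); first by left.
(* Since [u <= x], [ann u] contains [ann x], and maximality forces equality. It then suffices that
   [u] is orthogonal to [b]: a common lower bound [z] lies in the cone of [a] and [b], hence in
   [ann x], and below [x], so it is orthogonal to itself. *)
right; have ->: ann x = ann u.
  apply: contrapT => xu; apply: (xmax u u0 (le_trans ux xc)).
  by rewrite properEneq; split; [exact/eqP|exact: ann_anti].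
apply/annP => z zu zb; apply: ann_self.
apply: (ann_anti (le_trans zu ux)); apply: Lab; split=> //.
exact: le_trans ua.
Qed.

Lemma ACC_maximal (S : set P) : ACC_for_annihilators P -> S !=set0 ->
    S `<=` nonzero P ->
  exists2 x, S x & forall u, S u -> ~ ann x `<` ann u.
Proof.
move=> acc [s Ss] S0; apply: contrapT => nmax; apply: acc.
(* Membership in [S] is a premise inside the existential, so that choice gives a total map; its
   iterates from [s] form a forbidden chain. *)
have next x : exists u, S x -> S u /\ ann x `<` ann u.
  apply: contrapT => nex; apply: nmax; exists x.
    by apply: contrapT => nSx; apply: nex; exists x.
  by move=> u Su xu; apply: nex; exists u.
have [g gP] := choice next.
have Sg n : S (iter n g s) by elim: n => //= n /gP[].
exists (fun n => ann (iter n g s)); split=> n; last by case: (gP _ (Sg n)).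
by exists (iter n g s) => //; exact: S0.
Qed.

Lemma Ann_avoid c : ACC_for_annihilators P -> nonzero P c ->
  exists2 p, Ann P p & ~ p c.
Proof.
move=> acc c0.
have [|u []|x [x0 xc] xmax] :=
  @ACC_maximal [set u | nonzero P u /\ u <= c] acc; first by exists c.
- by [].
exists (ann x).
  split; last by exists x.
  by apply: (maximal_ann_prime (c := c)) => // u u0 uc; exact: xmax.
by move/(ann_down xc)/ann_self.
Qed.

(** Were [z] orthogonal to [x] but not to [y], a prime missing a nonzero common lower bound of [y]
    and [z] would contain neither of them, hence not [x], against primality. *)
Lemma ann_le_primes x y : ACC_for_annihilators P ->
  (forall p, Ann P p -> p x -> p y) -> ann x `<=` ann y.
Proof.
move=> acc xy z xz; apply: contrapT => /not_annP[w [wy wz w0]].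
have [p Ap npw] := Ann_avoid acc w0; have [pp _] := Ap.
apply: npw; case: (prime_ann pp xz) => [/(xy _ Ap)|]; exact: prime_down.
Qed.

(** A prime missing a nonzero [y] orthogonal to [x] must contain [x]. *)
Lemma Ann_mem x : ACC_for_annihilators P -> zero_divisors P x ->
  exists2 p, Ann P p & p x.
Proof.
move=> acc [y y0 axy]; have [p Ap npy] := Ann_avoid acc y0.
by exists p => //; case: (prime_ann Ap.1 axy).
Qed.

Lemma clique_card_le_Ann (C : set P) : ACC_for_annihilators P ->
  clique (Gamma P) C -> C #<= Ann P.
Proof.
move=> acc [Cv Cadj].
have avoid c : exists p, nonzero P c -> Ann P p /\ ~ p c.
  have [c0|c0] := pselect (nonzero P c); last by exists set0.
  by have [p] := Ann_avoid acc c0; exists p.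
have [f fP] := choice avoid.
have C0 c : C c -> nonzero P c by case/Cv.
apply: (@card_le_inj_in _ _ _ _ f) => [c /C0/fP[]//|x y Cx Cy fxy].
apply: contrapT => xy.
have [[px _] nfx] := fP _ (C0 _ Cx); have [_] := fP _ (C0 _ Cy).
by rewrite -fxy; case: (prime_ann px (Cadj _ _ Cx Cy xy)).
Qed.

Lemma Ann_generator_zero_divisor x : nonzero_zero_divisors P !=set0 ->
    ACC_for_annihilators P -> Ann P (ann x) ->
  nonzero_zero_divisors P x.
Proof.
move=> [z [[y y0 ayz] z0]] acc Ax.
(* Of the two nonzero orthogonal elements [y] and [z], one lies in the prime [ann x]. *)
have [u u0 xu] : exists2 u, nonzero P u & ann x u.
  by have [] := prime_ann Ax.1 ayz; [exists z|exists y].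
by split; [exists u|exact: Ann_generator_neq0].
Qed.

(** One clique of full size suffices: any bound on all clique sizes then bounds [Ann P]. *)
Lemma Ann_card_le_clique : nonzero_zero_divisors P !=set0 ->
    ACC_for_annihilators P ->
  exists2 C, clique (Gamma P) C & Ann P #<= C.
Proof.
move=> hZ acc.
have rep p : exists x, Ann P p -> p = ann x.
  by have [[_ [x ->]]|nAp] := pselect (Ann P p); [exists x|exists \bot].
have [g gP] := choice rep.
exists (g @` Ann P); last first.
  apply: (@card_le_inj_in _ _ _ _ g) => [p|p q Ap Aq gpq]; first by exists p.
  by rewrite (gP _ Ap) (gP _ Aq) gpq.
split=> [_ [p Ap <-]|_ _ [p Ap <-] [q Aq <-] gpq].
  by apply: Ann_generator_zero_divisor => //; rewrite -gP.
apply: Ann_orthogonal; rewrite -?gP //.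
by move=> pq; apply: gpq; rewrite pq.
Qed.

Lemma Ann_card_le_Gamma_E : nonzero_zero_divisors P !=set0 ->
  ACC_for_annihilators P -> Ann P #<= vertices (Gamma_E P).
Proof.
(* The set of all generators of [p] is the class of any one of them. *)
move=> hZ acc; apply: (@card_le_inj_in _ _ _ _ (fun p => [set y | p = ann y])).
  move=> p Ap; have [_ [x px]] := Ap; exists x; last by rewrite px.
  by apply: Ann_generator_zero_divisor; rewrite -?px.
move=> p q [_ [x px]] _ pq.
by have : [set y | p = ann y] x by []; rewrite pq => ->.
Qed.

Lemma Gamma_E_card3_Ann : ACC_for_annihilators P ->
  `I_3 #<= vertices (Gamma_E P) -> `I_3 #<= Ann P.
Proof.
move=> acc /card_le_I3P[_ [_ [_ [[[x Zx <-] [y Zy <-] [z Zz <-]] [xy xz yz]]]]].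
have [p Ap px] := Ann_mem acc Zx.1; have [q Aq qx] := Ann_avoid acc Zx.2.
have pq : p <> q by move=> pq; rewrite pq in px.
apply/card_le_I3P; apply: contrapT => n3.
have only r : Ann P r -> r = p \/ r = q.
  move=> Ar; apply: contrapT => /not_orP[rp rq]; apply: n3.
  by exists p, q, r; split; split=> // /esym.
(* Some prime contains [u] and some prime misses it, so exactly one of [p] and [q] contains [u]. *)
have one u : nonzero_zero_divisors P u -> (q u <-> ~ p u).
  move=> [/(Ann_mem acc)[r /only rpq ru] /(Ann_avoid acc)[s /only spq su]].
  split=> [qu pu|pu]; first by case: spq su => ->.
  by case: rpq ru => ->.
have same u v : nonzero_zero_divisors P u -> nonzero_zero_divisors P v ->
    (p u <-> p v) -> ann_class u = ann_class v.
  move=> /one qu /one qv puv; rewrite /ann_class; suff -> : ann u = ann v by [].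
  by apply/seteqP; split; apply: ann_le_primes => // r /only[] -> //; tauto.
(* Pigeonhole: two of [x], [y], [z] agree on membership in [p]. *)
have [py|py] := pselect (p y); first by apply: xy; apply: same.
have [pz|pz] := pselect (p z); first by apply: xz; apply: same.
by apply: yz; apply: same.
Qed.

End AnnihilatorPrimes.

Theorem proposition4p5 (d : Order.disp_t) (P : bPOrderType d)
    (hZ : nonzero_zero_divisors P !=set0)
    (hACC : ACC_for_annihilators P) :
  card_eq_clique_number (Ann P) (Gamma P) /\
  (`I_3 #<= Ann P <-> `I_3 #<= vertices (Gamma_E P)).
Proof.
split; [split=> [C|W B le_B]|split].
- exact: clique_card_le_Ann.
- have [C cC le_C] := Ann_card_le_clique hZ hACC.
  exact: card_le_trans le_C (le_B C cC).
- move=> le3; exact: card_le_trans le3 (Ann_card_le_Gamma_E hZ hACC).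
- exact: Gamma_E_card3_Ann.
Qed.
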